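(* Let $K$ be a field, let $I_1\subset R_1=K[\mathbf{x}]$ and $I_2\subset R_2=K[\mathbf{y}]$ be two (proper) monomial ideals in polynomial rings on disjoint finite sets of variables $\mathbf{x}$ and $\mathbf{y}$, and let $R=K[\mathbf{x},\mathbf{y}]$ and $I=I_1R+I_2R$. Then $\mathfrak{p}\in\mathrm{Ass}(R/I)$ if and only if $\mathfrak{p}=\mathfrak{p}_1R+\mathfrak{p}_2R$ for some $\mathfrak{p}_1\in\mathrm{Ass}(R_1/I_1)$ and $\mathfrak{p}_2\in\mathrm{Ass}(R_2/I_2)$.
   Context: $\mathrm{Ass}(R/I)$ denotes the set of associated prime ideals of $R/I$; for a monomial ideal $I$ these are precisely the prime ideals of the form $(I:f)$ with $f$ a monomial. *)

(* Defs.v *)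
From mathcomp Require Import all_boot all_algebra.
From mathcomp Require Import classical_sets.
From mathcomp Require Import mpoly.

Set Implicit Arguments.
Unset Strict Implicit.
Unset Printing Implicit Defensive.

Import GRing.Theory.
Local Open Scope classical_set_scope.
Local Open Scope ring_scope.

(* Ideals are propositional subsets [set R]: the [idealr_closed] and
   [prime_idealr_closed] of ring_quotient are about boolean predicates, and the
   former excludes the unit ideal. *)
Section Ideals.
Variable R : comNzRingType.
Implicit Types (I J P : set R) (f : R).

Definition is_ideal I : Prop :=
  [/\ I 0, forall x y, I x -> I y -> I (x + y) & forall a x, I x -> I (a * x)].

Definition is_proper I : Prop := ~ I 1.

Definition is_prime_ideal P : Prop :=
  [/\ is_ideal P, is_proper P & forall x y, P (x * y) -> P x \/ P y].

Definition ideal_gen (G : set R) : set R := smallest is_ideal G.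

Definition ideal_add I J : set R := [set x + y | x in I & y in J].

Definition colon I f : set R := [set g | I (g * f)].

(* [colon I f] is the annihilator of the class of [f] in the [R]-module
   [R / I]. *)
Definition Ass I : set (set R) :=
  [set P | is_prime_ideal P /\ exists f, P = colon I f].

End Ideals.

Definition ideal_ext (R S : comNzRingType) (phi : R -> S) (I : set R) : set S :=
  ideal_gen (phi @` I).

Definition monomial_ideal (K : fieldType) (n : nat) (I : set {mpoly K[n]}) :
    Prop :=
  exists M : set 'X_{1..n}, I = ideal_gen [set 'X_[K, mu] | mu in M].

(* [K[x, y]] is [{mpoly K[m + n]}]: the variables x are the first [m] ones and
   the variables y are the last [n] ones. *)
Section TwoBlocks.
Variables (K : fieldType) (m n : nat).

Definition incl_x (p : {mpoly K[m]}) : {mpoly K[m + n]} :=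
  p \mPo [tuple 'X_(lshift n i) | i < m].

Definition incl_y (p : {mpoly K[n]}) : {mpoly K[m + n]} :=
  p \mPo [tuple 'X_(rshift m j) | j < n].

Definition sum_ext (I1 : set {mpoly K[m]}) (I2 : set {mpoly K[n]}) :
    set {mpoly K[m + n]} :=
  ideal_add (ideal_ext incl_x I1) (ideal_ext incl_y I2).

End TwoBlocks.

(* Main.v *)
Require Import Defs.
From mathcomp Require Import all_boot all_algebra.
From mathcomp Require Import boolp classical_sets.
From mathcomp Require Import mpoly.

Set Implicit Arguments.
Unset Strict Implicit.
Unset Printing Implicit Defensive.

Import GRing.Theory.

(** A monomial ideal is the K-span of a set E of exponents closed under
    translation, so the lemma becomes a statement about such sets once the
    associated primes are described by exponents alone.  That description is
    [Ass_mono_span]: the associated primes of the span of E are the spans of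
    the translates [mono_colon E mu] = { a | a + mu in E } that are prime as
    sets of exponents ([prime_up]), that is, omit 0 and contain a or b whenever
    they contain a + b.

    Two facts carry it.  First, an associated prime (I : f), with f an arbitrary
    polynomial, is already (I : X^mu) for a monomial: multiplying f by a
    monomial outside the prime, and dropping the terms that fall into I, does
    not change the colon ideal, so f may be taken with as few terms as possible;
    then a monomial sends either all terms of f into I or none, and comparing
    leading monomials shows that the prime is spanned by the monomials of the
    first kind ([Ass_mono_span_witness]).  Second, the span of a prime set of
    exponents is a prime ideal, again by looking at a leading monomial
    ([prime_mono_span]).

    On exponents the sum I1 R + I2 R is the set [up_sum E1 E2] of the pairs with
    a component in E1 or in E2 ([sum_ext_mono_span]).  Taking translates
    commutes with this operation componentwise, and [up_sum D1 D2] is prime exactly when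
    both D1 and D2 are, because 0 belongs to neither. *)

(** * Ideals *)

Section IdealFacts.
Local Open Scope classical_set_scope.
Local Open Scope ring_scope.
Variable R : comNzRingType.
Implicit Types (I J P : set R) (f g x y : R).

Lemma is_ideal_gen (G : set R) : is_ideal (ideal_gen G).
Proof.
split=> [|x y Gx Gy|a x Gx] J JG; have [[J0 JD JM] _] := JG => //.
- by apply: JD; [apply: Gx | apply: Gy].
- by apply: JM; apply: Gx.
Qed.

Lemma ideal_gen_min {G I : set R} :
  is_ideal I -> G `<=` I -> ideal_gen G `<=` I.
Proof. exact: smallest_sub. Qed.

Lemma mem_ideal_gen {G : set R} {x : R} : G x -> ideal_gen G x.
Proof. exact: sub_gen_smallest. Qed.

Lemma is_ideal_add {I J : set R} :
  is_ideal I -> is_ideal J -> is_ideal (ideal_add I J).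
Proof.
move=> [I0 ID IM] [J0 JD JM]; split.
- by exists 0 => //; exists 0 => //; rewrite addr0.
- move=> _ _ [x Ix [y Jy <-]] [x' Ix' [y' Jy' <-]].
  exists (x + x'); first exact: ID.
  by exists (y + y'); [exact: JD | rewrite addrACA].
- move=> a _ [x Ix [y Jy <-]]; exists (a * x); first exact: IM.
  by exists (a * y); [exact: JM | rewrite mulrDr].
Qed.

Lemma ideal_sub {I x y} : is_ideal I -> I x -> I y -> I (x - y).
Proof.
by move=> [_ ID IM] Ix Iy; apply: ID => //; rewrite -mulN1r; apply: IM.
Qed.

Lemma ideal_subr {I x y} : is_ideal I -> I (x - y) -> I x <-> I y.
Proof.
move=> Iid Ixy; split=> [Ix | Iy].
  by rewrite -[y](subKr x); apply: ideal_sub.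
by rewrite -[x](subrK y); have [_ ID _] := Iid; apply: ID.
Qed.

(** The submodule of R / I generated by f is a copy of R / (I : f), a domain, so
    an element x outside (I : f) acts injectively on it. *)
Lemma colon_mul_prime {I f x} :
  is_prime_ideal (colon I f) -> ~ colon I f x -> colon I (f * x) = colon I f.
Proof.
move=> [[_ _ PM] _ Pp] Px; apply/seteqP; split=> g.
  by move=> Ig; have [] : colon I f g \/ colon I f x
    by apply: Pp; rewrite /colon /= -mulrA [x * f]mulrC.
by move=> /(PM x); rewrite /colon /= -mulrA mulrC mulrA.
Qed.

Lemma colon_congr {I f g} :
  is_ideal I -> I (f - g) -> colon I f = colon I g.
Proof.
move=> Iid Ifg; apply/seteqP.
have H h : I (h * f) <-> I (h * g).
  by apply: ideal_subr => //; rewrite -mulrBr; have [_ _ IM] := Iid; apply: IM.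
by split=> h /H.
Qed.

End IdealFacts.

(** * Monomial ideals as spans of sets of exponents *)

Section MonoSpan.
Local Open Scope classical_set_scope.
Local Open Scope ring_scope.
Variables (K : fieldType) (n : nat).
Implicit Types (E D : set 'X_{1..n}) (a b mu nu : 'X_{1..n}).
Implicit Types (p q f g h : {mpoly K[n]}).

Definition upset E : Prop := forall a b, E a -> E (a + b)%MM.

Definition mono_span E : set {mpoly K[n]} :=
  [set p | forall a, a \in msupp p -> E a].

Definition mono_colon E mu : set 'X_{1..n} := [set a | E (a + mu)%MM].

Definition prime_up D : Prop :=
  ~ D 0%MM /\ forall a b, D (a + b)%MM -> D a \/ D b.

Lemma upset_colon E mu : upset E -> upset (mono_colon E mu).
Proof.
move=> upE a b Ea; rewrite /mono_colon /=.
by rewrite -addmA [(b + mu)%MM]addmC addmA; apply: upE.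
Qed.

Lemma mono_spanX E a : mono_span E 'X_[a] <-> E a.
Proof.
split=> [/(_ a)|Ea b]; first by rewrite msuppX mem_seq1 eqxx; apply.
by rewrite msuppX mem_seq1 => /eqP->.
Qed.

Lemma is_ideal_mono_span E : upset E -> is_ideal (mono_span E).
Proof.
move=> upE; split=> [a | p q Ep Eq a | p q Eq a].
- by rewrite msupp0.
- by move=> /msuppD_le; rewrite mem_cat => /orP[/Ep|/Eq].
- move=> /msuppM_le /allpairsP[[b c] /= [_ /Eq Ec ->]].
  by rewrite addmC; apply: upE.
Qed.

Lemma linear_mono_span {k : nat} (phi : {linear {mpoly K[n]} -> {mpoly K[k]}})
    {E} {I : set {mpoly K[k]}} :
  is_ideal I -> (forall a, E a -> I (phi 'X_[a])) ->
  forall p, mono_span E p -> I (phi p).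
Proof.
move=> [I0 ID IM] EI p Ep; rewrite [p]mpolyE big_seq linear_sum.
apply: (big_ind I) => // a /Ep/EI Ia.
by rewrite linearZ /= -mul_mpolyC; apply: IM.
Qed.

Lemma mono_span_min {E} {I : set {mpoly K[n]}} :
  is_ideal I -> (forall a, E a -> I 'X_[a]) -> mono_span E `<=` I.
Proof. exact: (linear_mono_span (phi := idfun)). Qed.

Lemma monomial_idealP (I : set {mpoly K[n]}) :
  monomial_ideal I -> exists2 E, upset E & I = mono_span E.
Proof.
move=> [M ->]; pose E := [set a | exists2 mu, M mu & exists b, a = (mu + b)%MM].
have upE : upset E.
  move=> _ c [mu Mmu [b ->]]; exists mu => //.
  by exists (b + c)%MM; rewrite addmA.
exists E => //; apply/seteqP; split.
  apply: ideal_gen_min; first exact: is_ideal_mono_span.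
  move=> _ [mu Mmu <-]; apply/mono_spanX; exists mu => //.
  by exists 0%MM; rewrite addm0.
apply: mono_span_min => [|_ [mu Mmu [b ->]]]; first exact: is_ideal_gen.
have [_ _ IM] := @is_ideal_gen {mpoly K[n]} [set 'X_[K, mu] | mu in M].
by rewrite addmC mpolyXD; apply: IM; apply: mem_ideal_gen; exists mu.
Qed.

(** The normal form modulo the span of E: drop the terms in E. *)
Lemma mono_span_reduce E p : exists2 q, mono_span E (p - q) &
  forall a, a \in msupp q -> a \in msupp p /\ ~ E a.
Proof.
suff [q Hq] : exists q, forall a, q@_a = if `[< E a >] then 0 else p@_a.
  exists q => a; rewrite !mcoeff_msupp ?mcoeffB Hq; case: asboolP => //.
  - by rewrite subrr eqxx.
  - by rewrite eqxx.
elim/mpolyind: p => [|c b p _ _ [q Hq]].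
  by exists 0 => a; rewrite !mcoeff0 if_same.
exists (if `[< E b >] then q else c *: 'X_[b] + q) => a.
rewrite !mcoeffD mcoeffZ mcoeffX.
have [<-|ba] := eqVneq b a.
  by case: ifP => Eb; rewrite ?mcoeffD ?mcoeffZ ?mcoeffX Hq Eb ?eqxx.
case: ifP => _; rewrite ?mcoeffD ?mcoeffZ ?mcoeffX ?(negPf ba);
  by rewrite ?mulr0 ?add0r Hq.
Qed.

Lemma mlead_mul_mem {E g h} :
  mono_span E (g * h) -> g != 0 -> h != 0 -> E (mlead g + mlead h)%MM.
Proof.
move=> Egh g0 h0; apply: Egh.
by rewrite -mleadM // mlead_supp // mulf_neq0.
Qed.

Lemma colon_mono_span E mu :
  colon (mono_span E) 'X_[mu] = mono_span (mono_colon E mu).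
Proof.
apply/seteqP; split=> g Eg a.
  move=> ga; apply: Eg; rewrite (perm_mem (msuppMX _ _)).
  by apply/mapP; exists a; rewrite // addmC.
rewrite (perm_mem (msuppMX _ _)) => /mapP[b /Eg Eb ->].
by rewrite addmC.
Qed.

(** * Associated primes of a monomial ideal *)

(** For the converse, reduce two factors modulo the span: if neither vanishes,
    the leading monomial of the product is the sum of two exponents outside D
    and yet lies in D. *)
Lemma prime_mono_span {D} :
  upset D -> is_prime_ideal (mono_span D) <-> prime_up D.
Proof.
move=> upD; have Did := is_ideal_mono_span upD; split=> [[_ D1 Dp] | [D0 Dp]].
  split=> [D0|a b Dab]; first by apply: D1; rewrite -mpolyX0; apply/mono_spanX.
  have [] : mono_span D 'X_[a] \/ mono_span D 'X_[b].
  - by apply: Dp; rewrite -mpolyXD; apply/mono_spanX.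
  - by move=> /mono_spanX; left.
  - by move=> /mono_spanX; right.
split=> // [|x y Dxy]; first by rewrite /is_proper -mpolyX0 => /mono_spanX.
have [g Dxg gP] := mono_span_reduce D x.
have [h Dyh hP] := mono_span_reduce D y.
have [g0|g0] := eqVneq g 0; first by left; rewrite g0 subr0 in Dxg.
have [h0|h0] := eqVneq h 0; first by right; rewrite h0 subr0 in Dyh.
have Dgh : mono_span D (g * h).
  have [_ DD DM] := Did.
  apply: (ideal_subr Did _).1 Dxy.
  have -> : x * y - g * h = y * (x - g) + g * (y - h).
    by rewrite !mulrBr addrA [y * x]mulrC [y * g]mulrC subrK.
  by apply: DD; apply: DM.
have [Dg|Dh] := Dp _ _ (mlead_mul_mem Dgh g0 h0).
- by have [] := gP _ (mlead_supp g0).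
- by have [] := hP _ (mlead_supp h0).
Qed.

(** By induction on the number of terms of f: multiplying by monomials and
    reducing modulo the span lowers it until every monomial outside the prime
    keeps all terms of f out of the span.  Then the leading monomial of f is a
    witness. *)
Lemma Ass_mono_span_witness {E f} :
  upset E -> is_prime_ideal (colon (mono_span E) f) ->
  exists mu, colon (mono_span E) f = mono_span (mono_colon E mu).
Proof.
move=> upE; have Eid := is_ideal_mono_span upE.
have [k] := ubnP (size (msupp f)); elim: k => // k IH in f * => fk Pprime.
have [Pid P1 _] := Pprime.
have [[a [nu [Pa fnu Eanu]]] | uniform] := pselect (exists a nu,
    [/\ ~ colon (mono_span E) f 'X_[a], nu \in msupp f & E (nu + a)%MM]).
  (* X^a sends the term nu into the ideal, so f X^a reduces to fewer terms. *)
  have [q Eq qP] := mono_span_reduce E (f * 'X_[a]).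
  have colonE : colon (mono_span E) f = colon (mono_span E) q.
    by rewrite -(colon_congr Eid Eq) colon_mul_prime.
  rewrite colonE; apply: IH; last by rewrite -colonE.
  rewrite ltnS in fk; apply: leq_trans fk.
  have <- : size (msupp (f * 'X_[a])) = size (msupp f).
    by rewrite (perm_size (msuppMX _ _)) size_map.
  apply: (@uniq_leq_size _ ((a + nu)%MM :: msupp q)) => [/=|b].
    rewrite msupp_uniq andbT; apply/negP => /qP[_]; apply.
    by rewrite addmC.
  rewrite inE => /orP[/eqP->|/qP[]//].
  by rewrite (perm_mem (msuppMX _ _)); apply/mapP; exists nu.
have f0 : f != 0.
  apply: contra_notN P1 => /eqP->.
  by rewrite /colon /= mulr0; case: Eid.
have PX a : E (a + mlead f)%MM -> colon (mono_span E) f 'X_[a].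
  move=> Ea; apply: contrapT => Pa; apply: uniform.
  by exists a, (mlead f); split; rewrite // ?mlead_supp // addmC.
exists (mlead f); apply/seteqP; split; last exact: mono_span_min.
move=> g Pg; have [h Dgh hP] := mono_span_reduce (mono_colon E (mlead f)) g.
have [h0|h0] := eqVneq h 0; first by rewrite h0 subr0 in Dgh.
have Ph : colon (mono_span E) f h.
  by apply: (ideal_subr Pid _).1 Pg; apply: (mono_span_min Pid PX).
have [_ []] := hP _ (mlead_supp h0).
exact: mlead_mul_mem Ph h0 f0.
Qed.

Lemma Ass_mono_span E (P : set {mpoly K[n]}) : upset E ->
  Ass (mono_span E) P <->
  exists2 mu, prime_up (mono_colon E mu) & P = mono_span (mono_colon E mu).
Proof.
move=> upE; split.
  move=> [Pprime [f Pf]]; rewrite Pf in Pprime *.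
  have [mu Emu] := Ass_mono_span_witness upE Pprime.
  exists mu => //; apply/prime_mono_span; first exact: upset_colon.
  by rewrite -Emu.
move=> [mu Dprime ->]; split; last by exists 'X_[mu]; rewrite colon_mono_span.
by apply/prime_mono_span => //; apply: upset_colon.
Qed.

End MonoSpan.

Arguments mono_span K {n} E.
Arguments is_ideal_mono_span K {n E}.

(** * Two blocks of variables *)

Section Blocks.
Local Open Scope classical_set_scope.
Local Open Scope ring_scope.
Variables (K : fieldType) (m n : nat).
Implicit Types (a : 'X_{1..m}) (b : 'X_{1..n}) (c : 'X_{1..m + n}).
Implicit Types (E : set 'X_{1..m}) (F : set 'X_{1..n}).

Definition mnm_x c : 'X_{1..m} := [multinom c (lshift n i) | i < m].

Definition mnm_y c : 'X_{1..n} := [multinom c (rshift m j) | j < n].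

Definition mnm_pair a b : 'X_{1..m + n} :=
  [multinom match split k with inl i => a i | inr j => b j end | k < m + n].

Definition up_sum E F : set 'X_{1..m + n} :=
  [set c | E (mnm_x c) \/ F (mnm_y c)].

Lemma mnm_pair_l a b i : mnm_pair a b (lshift n i) = a i.
Proof. by rewrite mnmE (unsplitK (inl i)). Qed.

Lemma mnm_pair_r a b j : mnm_pair a b (rshift m j) = b j.
Proof. by rewrite mnmE (unsplitK (inr j)). Qed.

Lemma mnm_pairKx a b : mnm_x (mnm_pair a b) = a.
Proof. by apply/mnmP=> i; rewrite mnmE mnm_pair_l. Qed.

Lemma mnm_pairKy a b : mnm_y (mnm_pair a b) = b.
Proof. by apply/mnmP=> j; rewrite mnmE mnm_pair_r. Qed.

Lemma mnm_xD c c' : mnm_x (c + c')%MM = (mnm_x c + mnm_x c')%MM.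
Proof. by apply/mnmP=> i; rewrite !mnmE. Qed.

Lemma mnm_yD c c' : mnm_y (c + c')%MM = (mnm_y c + mnm_y c')%MM.
Proof. by apply/mnmP=> j; rewrite !mnmE. Qed.

Lemma mnm_x0 : mnm_x 0 = 0%MM.
Proof. by apply/mnmP=> i; rewrite !mnmE. Qed.

Lemma mnm_y0 : mnm_y 0 = 0%MM.
Proof. by apply/mnmP=> j; rewrite !mnmE. Qed.

Lemma incl_xX a : @incl_x K m n 'X_[a] = 'X_[mnm_pair a 0].
Proof.
rewrite /incl_x comp_mpolyX mpolyXE_id big_split_ord /= [X in _ * X]big1 ?mulr1.
  by apply: eq_bigr => i _; rewrite tnth_mktuple mnm_pair_l.
by move=> j _; rewrite mnm_pair_r mnm0E expr0.
Qed.

Lemma incl_yX b : @incl_y K m n 'X_[b] = 'X_[mnm_pair 0 b].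
Proof.
rewrite /incl_y comp_mpolyX mpolyXE_id big_split_ord /= [X in X * _]big1 ?mul1r.
  by apply: eq_bigr => j _; rewrite tnth_mktuple mnm_pair_r.
by move=> i _; rewrite mnm_pair_l mnm0E expr0.
Qed.

Lemma mpolyX_pair c :
  'X_[c] = incl_x n 'X_[mnm_x c] * incl_y m 'X_[mnm_y c] :> {mpoly K[m + n]}.
Proof.
rewrite incl_xX incl_yX -mpolyXD; congr 'X_[_]; apply/mnmP => k.
rewrite mnmDE; case: (split_ordP k) => i ->.
  by rewrite !mnm_pair_l mnm0E addn0 mnmE.
by rewrite !mnm_pair_r mnm0E add0n mnmE.
Qed.

Lemma upset_up_sum E F : upset E -> upset F -> upset (up_sum E F).
Proof.
move=> up1 up2 c d; rewrite /up_sum /= mnm_xD mnm_yD.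
by case=> [/up1|/up2]; [left | right].
Qed.

Lemma sum_ext_mono_span E F : upset E -> upset F ->
  sum_ext (mono_span K E) (mono_span K F) = mono_span K (up_sum E F).
Proof.
move=> up1 up2; have Sid := is_ideal_mono_span K (upset_up_sum up1 up2).
apply/seteqP; split.
  move=> _ [x Ix [y Iy <-]]; have [_ SD _] := Sid; apply: SD.
  - apply: (ideal_gen_min Sid) Ix => _ [p Ep <-].
    apply: (linear_mono_span (phi := comp_mpoly _) Sid _ Ep) => a Ea.
    by rewrite [_ 'X_[_]]incl_xX; apply/mono_spanX; left; rewrite mnm_pairKx.
  - apply: (ideal_gen_min Sid) Iy => _ [p Ep <-].
    apply: (linear_mono_span (phi := comp_mpoly _) Sid _ Ep) => b Fb.
    by rewrite [_ 'X_[_]]incl_yX; apply/mono_spanX; right; rewrite mnm_pairKy.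
have Xid : is_ideal (ideal_ext (@incl_x K m n) (mono_span K E)).
  exact: is_ideal_gen.
have Yid : is_ideal (ideal_ext (@incl_y K m n) (mono_span K F)).
  exact: is_ideal_gen.
have [[X0 _ XM] [Y0 _ YM]] := (Xid, Yid).
apply: (mono_span_min (is_ideal_add Xid Yid)) => c Ec.
rewrite mpolyX_pair; case: Ec => Ec.
  exists (incl_x n 'X_[mnm_x c] * incl_y m 'X_[mnm_y c]); last first.
    by exists 0; rewrite ?addr0.
  rewrite mulrC; apply: XM; apply: mem_ideal_gen.
  by exists 'X_[mnm_x c] => //; apply/mono_spanX.
exists 0 => //; exists (incl_x n 'X_[mnm_x c] * incl_y m 'X_[mnm_y c]).
  apply: YM; apply: mem_ideal_gen.
  by exists 'X_[mnm_y c] => //; apply/mono_spanX.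
by rewrite add0r.
Qed.

Lemma mono_colon_up_sum E F c : mono_colon (up_sum E F) c =
  up_sum (mono_colon E (mnm_x c)) (mono_colon F (mnm_y c)).
Proof.
by apply/seteqP; split=> d; rewrite /mono_colon /up_sum /= mnm_xD mnm_yD.
Qed.

(** Exponents of one block embed by putting 0 in the other block, where the
    condition for membership fails. *)
Lemma prime_up_sum E F :
  prime_up (up_sum E F) <-> prime_up E /\ prime_up F.
Proof.
split=> [[S0 Sp] | [[n1 p1] [n2 p2]]]; last first.
  split=> [|c d]; rewrite /up_sum /= ?mnm_x0 ?mnm_y0; first by case.
  by rewrite mnm_xD mnm_yD => -[/p1|/p2] []; tauto.
have n1 : ~ E 0%MM by move=> E0; apply: S0; left; rewrite mnm_x0.
have n2 : ~ F 0%MM by move=> E0; apply: S0; right; rewrite mnm_y0.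
split; split=> // a b Eab.
- have := Sp (mnm_pair a 0) (mnm_pair b 0).
  rewrite /up_sum /= mnm_xD mnm_yD !mnm_pairKx !mnm_pairKy.
  move=> /(_ (or_introl Eab)).
  tauto.
- have := Sp (mnm_pair 0 a) (mnm_pair 0 b).
  rewrite /up_sum /= mnm_xD mnm_yD !mnm_pairKx !mnm_pairKy.
  move=> /(_ (or_intror Eab)).
  tauto.
Qed.

End Blocks.

Theorem lemma3p8 (K : fieldType) (m n : nat)
    (I1 : set {mpoly K[m]}) (I2 : set {mpoly K[n]})
    (monI1 : monomial_ideal I1) (propI1 : is_proper I1)
    (monI2 : monomial_ideal I2) (propI2 : is_proper I2)
    (p : set {mpoly K[m + n]}) :
  Ass (sum_ext I1 I2) p <->
  exists (p1 : set {mpoly K[m]}) (p2 : set {mpoly K[n]}),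
    [/\ Ass I1 p1, Ass I2 p2 & p = sum_ext p1 p2].
Proof.
have [E1 up1 ->] := monomial_idealP monI1.
have [E2 up2 ->] := monomial_idealP monI2.
have upc1 mu := upset_colon (mu := mu) up1.
have upc2 mu := upset_colon (mu := mu) up2.
rewrite sum_ext_mono_span //; split.
  move=> /Ass_mono_span[|c]; first exact: upset_up_sum.
  rewrite mono_colon_up_sum => /prime_up_sum[pr1 pr2] ->.
  exists (mono_span K (mono_colon E1 (mnm_x c))).
  exists (mono_span K (mono_colon E2 (mnm_y c))).
  split; last by rewrite sum_ext_mono_span.
  - by apply/Ass_mono_span => //; exists (mnm_x c).
  - by apply/Ass_mono_span => //; exists (mnm_y c).
move=> [p1 [p2 [/Ass_mono_span[//|mu pr1 ->] /Ass_mono_span[//|nu pr2 ->] ->]]].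
apply/Ass_mono_span; first exact: upset_up_sum.
exists (mnm_pair mu nu); rewrite mono_colon_up_sum mnm_pairKx mnm_pairKy.
  by apply/prime_up_sum.
by rewrite sum_ext_mono_span.
Qed.
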